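(* Let $d\ge 1$ be an integer, let $A_1=\mathbb{I}$ be the $d\times d$ identity matrix and let $A_2$ be an arbitrary complex $d\times d$ matrix. Define the $2\times 2$ block matrices (of total size $2d\times 2d$) $$Z_1=\begin{pmatrix} A_1A_1^* & A_2A_1^*\\ A_1A_2^* & A_2A_2^*\end{pmatrix},\qquad Z_2=\begin{pmatrix} A_1^*A_1 & A_2^*A_1\\ A_1^*A_2 & A_2^*A_2\end{pmatrix}.$$ Then $$\left(\|Z_1\|_1-\operatorname{Tr} Z_1\right)^2+\left(\|Z_2\|_1-\operatorname{Tr} Z_2\right)^2\le\left(\sum_{i\ne j}\|A_i\|_2\,\|A_j\|_2\right)^2,$$ where the sum on the right is over ordered pairs $(i,j)$ with $i,j\in\{1,2\}$, $i\neq j$ (so the right-hand side equals $(2\|A_1\|_2\|A_2\|_2)^2$).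
   Context: For a complex matrix $X$, $X^*$ denotes the Hermitian conjugate (conjugate transpose) and $|X|=(X^*X)^{1/2}$ its modulus. $\|X\|_1=\operatorname{Tr}|X|$ is the trace norm (Schatten 1-norm) and $\|X\|_2=(\operatorname{Tr}X^*X)^{1/2}$ is the Frobenius norm (Schatten 2-norm). The matrices $Z_1$ and $Z_2$ are Hermitian but in general not positive semidefinite. *)

(* Defs.v *)
From HB Require Import structures.
From mathcomp Require Import all_boot all_order all_algebra.
From mathcomp Require Import complex.

Set Implicit Arguments.
Unset Strict Implicit.
Unset Printing Implicit Defensive.

Import Order.TTheory GRing.Theory Num.Theory.
Local Open Scope ring_scope.
Local Open Scope sesquilinear_scope.

Section MatrixNorms.
Context {C : numClosedFieldType}.

Definition psdmx n (M : 'M[C]_n) : Prop :=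
  M^t* = M /\ forall v : 'cV[C]_n, 0 <= \tr (v^t* *m M *m v).

(* Continuous functional calculus: if M = U^* diag(l) U with U unitary, this is
   U^* diag(sqrt l) U.  It is the positive square root when M is positive
   semidefinite (see sqrtmx_psd, sqrtmxK), the only case in which it is used. *)
Definition sqrtmx n (M : 'M[C]_n) : 'M[C]_n :=
  invmx (spectralmx M) *m diag_mx (map_mx sqrtC (spectral_diag M))
    *m spectralmx M.

Definition absmx m n (X : 'M[C]_(m, n)) : 'M[C]_n := sqrtmx (X^t* *m X).

(* Both norms are elements of C whose values are real and nonnegative.  The order
   on C is the partial one: x <= y iff y - x is a nonnegative real. *)
Definition trace_norm m n (X : 'M[C]_(m, n)) : C := \tr (absmx X).

Definition frob_norm m n (X : 'M[C]_(m, n)) : C := sqrtC (\tr (X^t* *m X)).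

Definition blockZ1 d (A : 'I_2 -> 'M[C]_d) : 'M[C]_(d + d) :=
  block_mx (A 0 *m (A 0)^t* ) (A 1 *m (A 0)^t* )
           (A 0 *m (A 1)^t* ) (A 1 *m (A 1)^t* ).

Definition blockZ2 d (A : 'I_2 -> 'M[C]_d) : 'M[C]_(d + d) :=
  block_mx ((A 0)^t* *m A 0) ((A 1)^t* *m A 0)
           ((A 0)^t* *m A 1) ((A 1)^t* *m A 1).

Lemma trmxC_mul m n p (A : 'M[C]_(m, n)) (B : 'M[C]_(n, p)) :
  (A *m B)^t* = B^t* *m A^t*.
Proof. by rewrite trmx_mul map_mxM. Qed.

Lemma gram_ge0 m n (X : 'M[C]_(m, n)) : 0 <= \tr (X^t* *m X).
Proof.
apply: sumr_ge0 => i _; rewrite mxE; apply: sumr_ge0 => j _.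
by rewrite !mxE mulrC mul_conjC_ge0.
Qed.

Lemma gram_psd m n (X : 'M[C]_(m, n)) : psdmx (X^t* *m X).
Proof.
split=> [|v]; first by rewrite trmxC_mul trmxCK.
by rewrite mulmxA -trmxC_mul -mulmxA gram_ge0.
Qed.

Lemma psd_spectral n (M : 'M[C]_n) : psdmx M ->
  M = (spectralmx M)^t* *m diag_mx (spectral_diag M) *m spectralmx M
  /\ forall i, 0 <= spectral_diag M 0 i.
Proof.
move=> [Mh M_ge0]; have Uu := spectral_unitarymx M.
have ME : M = (spectralmx M)^t* *m diag_mx (spectral_diag M) *m spectralmx M.
  rewrite -(invmx_unitary Uu); apply: (@orthomx_spectralP _ _ M).
  by apply/normalmxP; rewrite Mh.
split=> // i; set U := spectralmx M in ME Uu *; set l := spectral_diag M in ME *.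
have UU : U *m U^t* = 1%:M by apply/unitarymxP.
have := M_ge0 (U^t* *m delta_mx i 0).
rewrite trmxC_mul trmxCK {1}ME !mulmxA -(mulmxA _ U) UU mulmx1.
rewrite -(mulmxA _ U) UU mulmx1 -mulmxA mul_diag_mx /mxtrace big_ord1 mxE (bigD1 i) //=.
rewrite big1 ?addr0; first by rewrite !mxE !eqxx /= conjC1 mul1r mulr1.
by move=> j ji; rewrite !mxE (negPf ji) conjC0 mul0r.
Qed.

Lemma sqrtmxK n (M : 'M[C]_n) : psdmx M -> sqrtmx M *m sqrtmx M = M.
Proof.
move=> /psd_spectral [ME _]; rewrite /sqrtmx [RHS]ME.
rewrite -(invmx_unitary (spectral_unitarymx M)).
rewrite !mulmxA mulmxK ?spectral_unit // -(mulmxA (invmx _)).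
congr (_ *m _ *m _); rewrite mulmx_diag; congr diag_mx.
by apply/rowP=> i; rewrite !mxE -expr2 sqrtCK.
Qed.

Lemma sqrtmx_psd n (M : 'M[C]_n) : psdmx M -> psdmx (sqrtmx M).
Proof.
move=> /psd_spectral [_ l_ge0].
set D := diag_mx (map_mx (fun x => sqrtC (sqrtC x)) (spectral_diag M)).
suff -> : sqrtmx M = (D *m spectralmx M)^t* *m (D *m spectralmx M).
  exact: gram_psd.
rewrite /sqrtmx invmx_unitary ?spectral_unitarymx // trmxC_mul !mulmxA.
congr (_ *m _); rewrite -mulmxA; congr (_ *m _).
have -> : D^t* = D.
  rewrite tr_diag_mx map_diag_mx; congr diag_mx; apply/rowP=> i; rewrite !mxE.
  by apply: conj_Creal; apply: ger0_real; rewrite !sqrtC_ge0.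
rewrite mulmx_diag; congr diag_mx.
by apply/rowP=> i; rewrite !mxE -expr2 sqrtCK.
Qed.

End MatrixNorms.

(* Main.v *)
Require Import Defs.
From mathcomp Require Import all_boot all_order all_algebra.
From mathcomp Require Import complex reals.
From mathcomp Require Import ring.

Import Order.TTheory GRing.Theory Num.Theory.
Local Open Scope ring_scope.
Local Open Scope sesquilinear_scope.

(** Write A for A_2 and K = [A, A^*].  Then Z_1 = [I A]^* [I A] + diag (0, K) and
    Z_2 = [I A^*]^* [I A^*] - diag (0, K).  Vectors spanned by negative
    eigenvectors of Z_1 (resp. Z_2) have second components on which K is negative
    (resp. positive) definite, so the numbers k_1, k_2 of negative eigenvalues
    satisfy k_1 + k_2 <= d.  On the other hand ||Z_i||_1 - Tr Z_i is twice the
    negative part of the trace of Z_i, which is at most 2 |Tr (A G)| where G is an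
    off-diagonal block of the projection onto the negative eigenspace; as that
    projection has rank k_i, ||G||_2^2 <= k_i / 4, so by Cauchy-Schwarz
    (||Z_i||_1 - Tr Z_i)^2 <= 4 k_i ||A||_2^2. *)

Section Negativity.
Set Implicit Arguments.
Unset Strict Implicit.
Context {C : numClosedFieldType}.

(** * Spectra of Hermitian matrices, the trace norm and the negative part *)

Lemma hermitian_spectral n (Z : 'M[C]_n) : Z^t* = Z ->
  Z = (spectralmx Z)^t* *m diag_mx (spectral_diag Z) *m spectralmx Z
  /\ forall i, spectral_diag Z 0 i \is Num.real.
Proof.
move=> Zh; have Uu := spectral_unitarymx Z.
have UU : spectralmx Z *m (spectralmx Z)^t* = 1%:M by apply/unitarymxP.
have ZE : Z = (spectralmx Z)^t* *m diag_mx (spectral_diag Z) *m spectralmx Z.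
  rewrite -(invmx_unitary Uu); apply: (@orthomx_spectralP _ _ Z).
  by apply/normalmxP; rewrite Zh.
split=> // i.
have DE : spectralmx Z *m Z *m (spectralmx Z)^t* = diag_mx (spectral_diag Z).
  by rewrite {2}ZE !mulmxA UU mul1mx -mulmxA UU mulmx1.
have Dh : (diag_mx (spectral_diag Z))^t* = diag_mx (spectral_diag Z).
  by rewrite -DE !trmxC_mul trmxCK Zh mulmxA.
apply/CrealP; move/matrixP/(_ i i): Dh.
by rewrite !mxE eqxx !mulr1n.
Qed.

(* The change of basis Q between two eigenbases of Z^* Z intertwines its two
   diagonal forms, hence also their square roots. *)
Lemma trace_norm_spectral n (Z : 'M[C]_n) : Z^t* = Z ->
  trace_norm Z = \sum_i `|spectral_diag Z 0 i|.
Proof.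
move=> Zh; have [ZE lr] := hermitian_spectral Zh.
set U := spectralmx Z in ZE; set l := spectral_diag Z in ZE lr *.
have UU : U *m U^t* = 1%:M by apply/unitarymxP/spectral_unitarymx.
have UU' : U^t* *m U = 1%:M by apply: mulmx1C.
have [ME _] := psd_spectral (gram_psd Z).
rewrite /trace_norm /absmx /sqrtmx; set M := Z^t* *m Z in ME *.
rewrite invmx_unitary ?spectral_unitarymx //.
have VV : spectralmx M *m (spectralmx M)^t* = 1%:M.
  by apply/unitarymxP/spectral_unitarymx.
set V := spectralmx M in ME VV *; set m := spectral_diag M in ME *.
have VV' : V^t* *m V = 1%:M by apply: mulmx1C.
pose Q := V *m U^t*.
have QQ : Q^t* *m Q = 1%:M.
  by rewrite /Q trmxC_mul trmxCK mulmxA -(mulmxA U) VV' mulmx1.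
have M2 : M = U^t* *m (diag_mx l *m diag_mx l) *m U.
  rewrite /M Zh {1 2}ZE !mulmxA; congr (_ *m _ *m _).
  by rewrite -(mulmxA _ U) UU mulmx1.
have QE : Q *m (diag_mx l *m diag_mx l) = diag_mx m *m Q.
  transitivity (V *m M *m U^t* ).
    by rewrite M2 /Q !mulmxA -(mulmxA _ U) UU mulmx1.
  by rewrite ME /Q !mulmxA VV mul1mx.
have QU : V = Q *m U by rewrite /Q -mulmxA UU' mulmx1.
clearbody Q.
have QS : Q *m diag_mx (map_mx Num.norm l) = diag_mx (map_mx sqrtC m) *m Q.
  rewrite mul_mx_diag mul_diag_mx; apply/matrixP=> i j; rewrite !mxE.
  move/matrixP/(_ i j): QE; rewrite mulmx_diag mul_mx_diag mul_diag_mx !mxE.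
  (* Where [Q i j] is nonzero, [QE] forces [m_i = l_j ^+ 2]; as [l_j] is real, the square root of
     [m_i] is the modulus of [l_j]. *)
  have [->|Q0] := eqVneq (Q i j) 0; first by rewrite !(mulr0, mul0r).
  rewrite [RHS]mulrC => /(mulfI Q0) <-; rewrite mulrC; congr (_ * _).
  by rewrite -expr2 -(real_normK (lr j)) sqrCK.
have -> : V^t* *m diag_mx (map_mx sqrtC m) *m V
    = U^t* *m diag_mx (map_mx Num.norm l) *m U.
  rewrite QU trmxC_mul !mulmxA -[_ *m diag_mx _ *m Q]mulmxA -QS !mulmxA.
  by rewrite -[_ *m Q]mulmxA QQ mulmx1.
rewrite mxtrace_mulC mulmxA UU mul1mx mxtrace_diag.
by apply: eq_bigr => i _; rewrite mxE.
Qed.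

(** The rows of [W] are the eigenvectors with negative eigenvalue. An eigenvalue x contributes |x| -
    x to the left side, which is 0 for x >= 0 and -2x otherwise. *)
Lemma negative_part n (Z : 'M[C]_n) : Z^t* = Z ->
  exists k (W : 'M[C]_(k, n)) (l : 'rV[C]_k),
  [/\ W *m W^t* = 1%:M, W *m Z *m W^t* = diag_mx l, forall i, l 0 i < 0
    & trace_norm Z - \tr Z = - 2 * \sum_i l 0 i].
Proof.
move=> Zh; have [ZE lr] := hermitian_spectral Zh.
rewrite trace_norm_spectral //.
set U := spectralmx Z in ZE; set l := spectral_diag Z in ZE lr *.
have UU : U *m U^t* = 1%:M by apply/unitarymxP/spectral_unitarymx.
pose P := [pred i | l 0 i < 0].
pose f (i : 'I_#|P|) : 'I_n := enum_val i.
exists #|P|, (rowsub f U), (colsub f l).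
have subE (N : 'M_n) :
    rowsub f U *m N *m (rowsub f U)^t* = mxsub f f (U *m N *m U^t* ).
  by apply/matrixP=> i j; rewrite !mxE; apply: eq_bigr => k _; rewrite !mxE;
     congr (_ * _); apply: eq_bigr => h _; rewrite !mxE.
have fI : injective f by apply: enum_val_inj.
split.
- have := subE 1%:M; rewrite !mulmx1 UU => ->.
  by apply/matrixP=> i j; rewrite !mxE (inj_eq fI).
- rewrite subE [in LHS]ZE !mulmxA UU mul1mx -mulmxA UU mulmx1.
  by apply/matrixP=> i j; rewrite !mxE (inj_eq fI).
- by move=> i; rewrite mxE; have := enum_valP i; rewrite inE.
- have -> : \tr Z = \sum_i l 0 i.
    by rewrite [Z in LHS]ZE mxtrace_mulC mulmxA UU mul1mx mxtrace_diag.
  rewrite -sumrB (bigID P) /= [X in _ + X]big1 ?addr0 => [|i]; last first.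
    by rewrite -real_leNgt ?real0 // => l0; rewrite ger0_norm ?subrr.
  rewrite mulr_sumr; transitivity (\sum_(i in P) (- 2 * l 0 i)).
    apply: eq_big => [i|i l0]; first by rewrite inE.
    by rewrite ltr0_norm // mulNr mulr_natl mulr2n opprD.
  by rewrite big_enum_val; apply: eq_bigr => i _; rewrite mxE.
Qed.

(** * The common block form of Z_1 and Z_2 *)

(** When A_1 = I, Z_1 is [gramblock] at A_2 and Z_2 is [gramblock] at A_2^*, so that each estimate
    below serves both. *)
Definition gramblock d (B : 'M[C]_d) : 'M[C]_(d + d) :=
  block_mx 1%:M B (B^t* ) (B *m B^t* ).

Lemma gramblock_form d p (B : 'M[C]_d) (X Y : 'M[C]_(p, d)) :
  row_mx X Y *m gramblock B *m (row_mx X Y)^t*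
  = X *m X^t* + Y *m B^t* *m X^t* + X *m B *m Y^t*
    + Y *m B *m (Y *m B)^t*.
Proof.
rewrite /gramblock mul_row_block tr_row_mx map_col_mx mul_row_col mulmx1.
by rewrite !mulmxDl !addrA trmxC_mul !mulmxA.
Qed.

Lemma gramblock_herm d (B : 'M[C]_d) : (gramblock B)^t* = gramblock B.
Proof.
rewrite /gramblock tr_block_mx map_block_mx trmxC_mul trmxCK.
by rewrite tr_scalar_mx map_scalar_mx /= conjC1.
Qed.

Lemma trmxCD m n (X Y : 'M[C]_(m, n)) : (X + Y)^t* = X^t* + Y^t*.
Proof. by rewrite linearD /= map_mxD. Qed.

Lemma trmxCN m n (X : 'M[C]_(m, n)) : (- X)^t* = - X^t*.
Proof. by rewrite linearN /= map_mxN. Qed.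

Lemma trmxC1 n : (1%:M : 'M[C]_n)^t* = 1%:M.
Proof. by rewrite tr_scalar_mx map_scalar_mx /= conjC1. Qed.

Lemma trmxCZ m n (a : C) (X : 'M[C]_(m, n)) :
  a \is Num.real -> (a *: X)^t* = a *: X^t*.
Proof.
by move=> ar; apply/matrixP=> i j; rewrite !mxE rmorphM /= conj_Creal.
Qed.

(** * Bounds on the negative trace and on the numbers of negative eigenvalues *)

Lemma cogram_ge0 m n (X : 'M[C]_(m, n)) : 0 <= \tr (X *m X^t* ).
Proof. by rewrite mxtrace_mulC gram_ge0. Qed.

(* [Y^t* *m X] is an off-diagonal block of a projection of rank k, so its singular
   values are at most 1/2. *)
Lemma offdiag_frob k d (X Y : 'M[C]_(k, d)) :
  X *m X^t* + Y *m Y^t* = 1%:M ->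
  4 * \tr ((Y^t* *m X)^t* *m (Y^t* *m X)) <= k%:R.
Proof.
move=> XY1; set S := X *m X^t*.
have Sh : S^t* = S by rewrite /S trmxC_mul trmxCK.
have YE : Y *m Y^t* = 1%:M - S by rewrite -XY1 addrC addKr.
have -> : \tr ((Y^t* *m X)^t* *m (Y^t* *m X)) = \tr S - \tr (S *m S).
  rewrite trmxC_mul trmxCK mulmxA [LHS]mxtrace_mulC 2![in LHS]mulmxA -/S.
  by rewrite -(mulmxA S Y) YE mulmxBr mulmx1 raddfB.
(* The bound tr (S - S^2) <= k/4 is the expansion of tr (1 - 2S)^2 >= 0. *)
have := gram_ge0 (1%:M - S - S).
rewrite !(trmxCD, trmxCN, trmxC1) Sh !(mulmxBl, mulmxBr, mul1mx, mulmx1).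
rewrite !raddfB /= mxtrace1 => h.
by rewrite -subr_ge0; apply: le_trans h _; rewrite le_eqVlt; apply/orP; left;
   apply/eqP; ring.
Qed.

Lemma gramblock_form_sqr d k (B : 'M[C]_d) (X Y : 'M[C]_(k, d)) :
  X *m X^t* + Y *m Y^t* = 1%:M ->
  \tr (row_mx X Y *m gramblock B *m (row_mx X Y)^t* ) <= 0 ->
  \tr (row_mx X Y *m gramblock B *m (row_mx X Y)^t* ) ^+ 2
    <= k%:R * \tr (B^t* *m B).
Proof.
have [k0|k_gt0] := posnP k.
  by subst k; rewrite mul0r /mxtrace big_ord0 expr0n lexx.
move=> XY1; rewrite gramblock_form !raddfD /=.
set G := Y^t* *m X.
have -> : \tr (X *m B *m Y^t* ) = \tr (B *m G).
  by rewrite -mulmxA mxtrace_mulC mulmxA.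
have -> : \tr (Y *m B^t* *m X^t* ) = \tr (G^t* *m B^t* ).
  by rewrite /G trmxC_mul trmxCK mxtrace_mulC mulmxA.
have := offdiag_frob XY1; rewrite -/G.
have := cogram_ge0 X; have := cogram_ge0 (Y *m B).
set a := \tr (X *m _); set b := \tr (Y *m B *m _).
set p := \tr (G^t* *m B^t* ); set q := \tr (B *m G); set g := \tr (G^t* *m G).
move=> b0 a0 gk; set t := _ + b => t0.
have B0 := gram_ge0 B; set c := \tr (B^t* *m B) in B0 *.
(* Cauchy-Schwarz in discriminant form: this expands the squared Frobenius norm of [B^t* + s *: G].
   Taking [s >= 0] allows [p + q] to be replaced by the larger [t] in [h1]. *)
have key (s : C) : 0 <= s -> 0 <= c + s * (p + q) + s ^+ 2 * g.
  move=> s0; have sr := ger0_real s0.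
  have := gram_ge0 (B^t* + s *: G).
  rewrite trmxCD trmxCZ // trmxCK mulmxDl !mulmxDr !raddfD /=.
  rewrite -!scalemxAl -!scalemxAr !linearZ /= -/p -/q -/g.
  rewrite [\tr (B *m _)]mxtrace_mulC -/c => h; apply: le_trans h _.
  by rewrite le_eqVlt; apply/orP; left; apply/eqP; ring.
have kP : 0 < k%:R :> C by rewrite ltr0n.
(* The minimiser of s |-> c + s t + s^2 k/4, where the value is c - t^2/k; it is nonnegative because
   [t <= 0]. *)
pose s := - 2 * t / k%:R.
have s0 : 0 <= s by rewrite divr_ge0 ?ler0n // mulNr oppr_ge0 pmulr_rle0.
have h1 : 0 <= c + s * t + s ^+ 2 * (k%:R / 4).
  apply: le_trans (key s s0) _; rewrite -!addrA lerD2l lerD //.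
    rewrite ler_wpM2l // /t -subr_ge0.
    have -> : a + p + q + b - (p + q) = a + b by ring.
    exact: addr_ge0.
  by rewrite ler_wpM2l ?exprn_ge0 // ler_pdivlMr // mulrC.
have := mulr_ge0 (ltW kP) h1; rewrite -[t ^+ 2 <= _]subr_ge0 => h2.
apply: le_trans h2 _; rewrite le_eqVlt; apply/orP; left; apply/eqP.
by rewrite /s; field; rewrite gt_eqF.
Qed.

(** The second components of the two families of negative eigenvectors are jointly independent in
    dimension [d]: a dependency yields vectors (x1, y) and (x2, -y) in the two negative spans, on
    which the forms cannot both be negative. *)
Lemma negative_ranks d k1 k2 (B : 'M[C]_d) (W1 : 'M[C]_(k1, d + d))
    (W2 : 'M[C]_(k2, d + d)) (l1 : 'rV[C]_k1) (l2 : 'rV[C]_k2) :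
  W1 *m gramblock B *m W1^t* = diag_mx l1 ->
  W2 *m gramblock (B^t* ) *m W2^t* = diag_mx l2 ->
  (forall i, l1 0 i < 0) -> (forall i, l2 0 i < 0) -> (k1 + k2 <= d)%N.
Proof.
move=> E1 E2 l1_lt0 l2_lt0.
pose Y := col_mx (rsubmx W1) (rsubmx W2).
suff /eqP <- : row_free Y by apply: rank_leq_col.
apply: inj_row_free => v; rewrite -[v]hsubmxK mul_row_col.
set v1 := lsubmx v; set v2 := rsubmx v => Y0.
pose x1 := v1 *m lsubmx W1; pose y := v1 *m rsubmx W1.
pose x2 := v2 *m lsubmx W2.
have y2E : v2 *m rsubmx W2 = - y by apply/eqP; rewrite -addr_eq0 addrC Y0.
have W1E : v1 *m W1 = row_mx x1 y by rewrite -[W1]hsubmxK mul_mx_row.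
have W2E : v2 *m W2 = row_mx x2 (- y) by rewrite -[W2]hsubmxK mul_mx_row y2E.
have F1 : v1 *m diag_mx l1 *m v1^t*
    = row_mx x1 y *m gramblock B *m (row_mx x1 y)^t*.
  by rewrite -E1 -W1E trmxC_mul !mulmxA.
have F2 : v2 *m diag_mx l2 *m v2^t*
    = row_mx x2 (- y) *m gramblock (B^t* ) *m (row_mx x2 (- y))^t*.
  by rewrite -E2 -W2E trmxC_mul !mulmxA.
clearbody x1 x2 y.
(* The commutator terms of the two forms cancel, leaving |x1 + y B^*|^2 + |x2 - y B|^2. *)
have sum0 : 0 <= \tr (v1 *m diag_mx l1 *m v1^t* ) + \tr (v2 *m diag_mx l2 *m v2^t* ).
  rewrite F1 F2 !gramblock_form trmxCK.
  have := addr_ge0 (cogram_ge0 (x1 + y *m B^t* )) (cogram_ge0 (x2 - y *m B)).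
  rewrite !(trmxCD, trmxCN, trmxC_mul, trmxCK).
  rewrite !(mulmxDl, mulmxDr, mulNmx, mulmxN, opprK) !mulmxA.
  rewrite !(raddfD, raddfN) /= => h; apply: le_trans h _.
  by rewrite le_eqVlt; apply/orP; left; apply/eqP; ring.
have quad k (w : 'rV[C]_k) (l : 'rV[C]_k) :
    \tr (w *m diag_mx l *m w^t* ) = \sum_i l 0 i * `|w 0 i| ^+ 2.
  rewrite mul_mx_diag /mxtrace big_ord1 mxE; apply: eq_bigr => i _.
  by rewrite !mxE normCK mulrAC mulrC mulrA.
have quad_le0 k (w : 'rV[C]_k) (l : 'rV[C]_k) : (forall i, l 0 i < 0) ->
    \tr (w *m diag_mx l *m w^t* ) <= 0 ?= iff (w == 0).
  move=> l0.
  have term_le0 i : l 0 i * `|w 0 i| ^+ 2 <= 0.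
    exact: mulr_le0_ge0 (ltW (l0 i)) (exprn_ge0 _ (normr_ge0 _)).
  split.
    by rewrite quad; apply: sumr_le0 => i _; exact: term_le0.
  apply/eqP/eqP => [|->]; last by rewrite !mul0mx raddf0.
  rewrite quad => /eqP; rewrite -oppr_eq0 -sumrN psumr_eq0; last first.
    by move=> i _; rewrite oppr_ge0 term_le0.
  move/allP=> h; apply/rowP=> i; have := h i (mem_index_enum i).
  by rewrite oppr_eq0 mulf_eq0 (lt_eqF (l0 i)) /= expf_eq0 /= normr_eq0 mxE => /eqP.
(* The sum is at most 0, with equality only if [v1] and [v2] both vanish; [sum0] forces equality. *)
have := leifD (quad_le0 _ v1 l1 l1_lt0) (quad_le0 _ v2 l2 l2_lt0).
rewrite addr0 => -[le0 eq0]; move: eq0; rewrite eq_le le0 sum0 /=.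
by case/esym/andP=> /eqP-> /eqP->; rewrite row_mx0.
Qed.

(** * Combination of the two bounds *)

(** The witnesses stay in the conclusion so that [negative_ranks] can compare the values of [k] for
    [B] and its adjoint. *)
Lemma negativity_bound d (B : 'M[C]_d) :
  exists k (W : 'M[C]_(k, d + d)) (l : 'rV[C]_k),
  [/\ W *m gramblock B *m W^t* = diag_mx l, forall i, l 0 i < 0
    & (trace_norm (gramblock B) - \tr (gramblock B)) ^+ 2
      <= 4 * (k%:R * \tr (B^t* *m B))].
Proof.
have [k [W [l [Wu WE l0 trE]]]] := negative_part (gramblock_herm B).
exists k, W, l; split=> //.
have -> : (trace_norm (gramblock B) - \tr (gramblock B)) ^+ 2
    = 4 * (\tr (W *m gramblock B *m W^t* )) ^+ 2.
  by rewrite trE WE mxtrace_diag; ring.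
rewrite ler_pM2l // -[W]hsubmxK; apply: gramblock_form_sqr.
  by rewrite -Wu -[W]hsubmxK tr_row_mx map_col_mx mul_row_col !hsubmxK.
by rewrite hsubmxK WE mxtrace_diag sumr_le0 // => i _; apply: ltW.
Qed.

Lemma sum_negativity_bound d (B : 'M[C]_d) :
  (trace_norm (gramblock B) - \tr (gramblock B)) ^+ 2
    + (trace_norm (gramblock (B^t* )) - \tr (gramblock (B^t* ))) ^+ 2
  <= 4 * (d%:R * \tr (B^t* *m B)).
Proof.
have [k1 [W1 [l1 [W1E l1_lt0 le1]]]] := negativity_bound B.
have [k2 [W2 [l2 [W2E l2_lt0 le2]]]] := negativity_bound (B^t* ).
have le_d := negative_ranks W1E W2E l1_lt0 l2_lt0.
apply: le_trans (lerD le1 le2) _.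
rewrite trmxCK [\tr (B *m _)]mxtrace_mulC -mulrDr -mulrDl -natrD.
by rewrite ler_pM2l // ler_wpM2r ?gram_ge0 // ler_nat.
Qed.

End Negativity.

Theorem mainTheorem1 (R : realType) (d : nat) (hd : (1 <= d)%N)
    (A : 'I_2 -> 'M[R[i]]_d) (hA : A 0 = 1%:M) :
  (trace_norm (blockZ1 A) - \tr (blockZ1 A)) ^+ 2
    + (trace_norm (blockZ2 A) - \tr (blockZ2 A)) ^+ 2
  <= (\sum_(i : 'I_2) \sum_(j : 'I_2 | i != j)
        frob_norm (A i) * frob_norm (A j)) ^+ 2.
Proof.
have -> : blockZ1 A = gramblock (A 1).
  by rewrite /blockZ1 /gramblock hA trmxC1 !(mulmx1, mul1mx).
have -> : blockZ2 A = gramblock ((A 1)^t* ).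
  by rewrite /blockZ2 /gramblock hA trmxC1 trmxCK !(mulmx1, mul1mx).
set B := A 1.
apply: le_trans (sum_negativity_bound B) _.
have -> : \sum_(i : 'I_2) \sum_(j : 'I_2 | i != j) frob_norm (A i) * frob_norm (A j)
    = 2 * (frob_norm (A 0) * frob_norm B).
  have -> : \sum_(i : 'I_2) \sum_(j : 'I_2 | i != j) frob_norm (A i) * frob_norm (A j)
    = \sum_(i < 2) \sum_(j < 2) (if i != j then frob_norm (A i) * frob_norm (A j) else 0).
    by apply: eq_bigr => i _; rewrite big_mkcond.
  rewrite !big_ord_recl !big_ord0 /=.
  have -> : lift ord0 (ord0 : 'I_1) = 1 :> 'I_2 by apply/val_inj.
  by rewrite -/B; ring.
(* The factor [d] in the bound is the squared Frobenius norm of the identity. *)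
rewrite !exprMn /frob_norm !sqrtCK hA trmxC1 mulmx1 mxtrace1.
by have -> : (2 : R[i]) ^+ 2 = 4 by ring.
Qed.
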